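(* Let $\mathcal{I}$ be an ideal on $\omega$ such that there are pairwise disjoint subsets $(B_j)_{j\in\omega}$ of $\omega$ with $B_j\notin\mathcal{I}$ for every $j\in\omega$. Then $\bigcup_{2\leq n<\omega}\Gamma(\mathcal{I},n)$ is densely lineable in $\ell_\infty$.
   Context: $\ell_\infty$ is the real Banach space of bounded real sequences $x=(x(n))_{n\in\omega}$ with the supremum norm, where $\omega=\{0,1,2,\dots\}$. An ideal $\mathcal{I}$ on $\omega$ is a proper subfamily of $\mathcal{P}(\omega)$ which is closed under subsets and finite unions and contains all singletons of $\omega$. For $x\in\ell_\infty$, $\Gamma_x(\mathcal{I})$ is the set of $\mathcal{I}$-cluster points of $x$, i.e. the set of all $\eta\in\mathbb{R}$ such that $\{n\in\omega:|x(n)-\eta|<\varepsilon\}\notin\mathcal{I}$ for all $\varepsilon>0$. For a cardinal $\kappa$, $\Gamma(\mathcal{I},\kappa)=\{x\in\ell_\infty: |\Gamma_x(\mathcal{I})|=\kappa\}$. A subset $M$ of a topological vector space $X$ is densely lineable in $X$ if $M\cup\{0\}$ contains a linear subspace that is dense in $X$. *)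

(* Defs.v *)
From HB Require Import structures.
From mathcomp Require Import all_boot all_order all_algebra.
From mathcomp Require Import all_classical all_reals all_analysis.

Set Implicit Arguments.
Unset Strict Implicit.
Unset Printing Implicit Defensive.

Import Order.TTheory GRing.Theory Num.Theory.
Import numFieldNormedType.Exports.

Local Open Scope classical_set_scope.
Local Open Scope ring_scope.

Definition bounded_seq (R : realType) : {pred nat -> R} :=
  mem [set x : nat -> R | bounded_fun x].

Lemma bounded_seqP (R : realType) (x : nat -> R) :
  reflect (exists M, forall n, `|x n| <= M) (x \in @bounded_seq R).
Proof.
apply: (iffP idP) => [/set_mem/pinfty_ex_gt0[M M0 xM]|[M xM]].
  by exists M => n; exact: (xM n).
apply/mem_set; exists M; split=> [|N MN n _ /=]; first exact: num_real.
exact: le_trans (xM n) (ltW MN).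
Qed.

Lemma bounded_seq_submod (R : realType) : submod_closed (@bounded_seq R).
Proof.
split=> [|a x y /bounded_seqP[M xM] /bounded_seqP[N yN]]; apply/bounded_seqP.
  by exists 0 => n; rewrite normr0.
exists (`|a| * M + N) => n; apply: le_trans (ler_normD _ _) _.
by apply: lerD (yN n); rewrite normrM ler_wpM2l.
Qed.

HB.instance Definition _ (R : realType) :=
  GRing.isSubmodClosed.Build R (nat -> R) (@bounded_seq R)
    (@bounded_seq_submod R).

Record linfty (R : realType) :=
  Linfty { linfty_seq :> nat -> R ; _ : linfty_seq \in @bounded_seq R }.

Section linfty_normed.
Context {R : realType}.
Implicit Types x y : linfty R.

HB.instance Definition _ := [isSub for @linfty_seq R].
HB.instance Definition _ := [Choice of linfty R by <:].
HB.instance Definition _ := [SubChoice_isSubLmodule of linfty R by <:].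

Definition linfty_norm x : R := sup (range (fun n => `|x n|)).

Lemma linfty_norm_has_sup x : has_sup (range (fun n => `|x n|)).
Proof.
split; first by exists `|x 0%N|, 0%N.
by have /bounded_seqP[M xM] := valP x; exists M => _ [n _ <-]; exact: xM.
Qed.

Lemma le_linfty_norm x n : `|x n| <= linfty_norm x.
Proof. by apply: sup_upper_bound (linfty_norm_has_sup x) _ _; exists n. Qed.

Lemma linfty_norm_le x M : (forall n, `|x n| <= M) -> linfty_norm x <= M.
Proof.
move=> xM; apply: ge_sup => [|_ [n _ <-]]; last exact: xM.
by case: (linfty_norm_has_sup x).
Qed.

Lemma linfty_normD x y : linfty_norm (x + y) <= linfty_norm x + linfty_norm y.
Proof.
apply: linfty_norm_le => n; apply: le_trans (ler_normD _ _) _.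
by apply: lerD; exact: le_linfty_norm.
Qed.

Lemma linfty_normZ (a : R) x : linfty_norm (a *: x) = `|a| * linfty_norm x.
Proof.
have leZ b y : linfty_norm (b *: y) <= `|b| * linfty_norm y.
  apply: linfty_norm_le => n; rewrite [`|_|]normrM ler_wpM2l//.
  exact: le_linfty_norm.
apply/eqP; rewrite eq_le leZ /=.
have [->|a0] := eqVneq a 0.
  by rewrite normr0 mul0r (le_trans _ (le_linfty_norm _ 0%N)).
rewrite -ler_pdivlMl ?normr_gt0//.
by have := leZ a^-1 (a *: x); rewrite scalerA mulVf// scale1r normfV.
Qed.

Lemma linfty_norm_eq0 x : linfty_norm x = 0 -> x = 0.
Proof.
move=> x0; apply/val_inj/funext => n; apply/normr0_eq0/eqP.
by rewrite -normr_le0 normr_id -x0; exact: le_linfty_norm.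
Qed.

HB.instance Definition _ := Lmodule_isNormed.Build R (linfty R)
  linfty_normD linfty_normZ linfty_norm_eq0.

Lemma le_linfty_dist x y n : `|x n - y n| <= `|x - y|.
Proof. exact: (le_linfty_norm (x - y) n). Qed.

Lemma linfty_complete (F : set_system (linfty R)) :
  ProperFilter F -> cauchy F -> cvg F.
Proof.
move=> FF Fc.
have Fe e : 0 < e -> exists p, F [set x : linfty R | `|p - x| < e].
  move=> e0; have /cauchyP/(_ e e0)[p Fp] := Fc.
  by exists p; move: Fp; rewrite -ball_normE.
have Fn n : cvg ((fun x : linfty R => x n) @ F).
  apply: R_complete; apply: cauchy_exP => e e0.
  have [p Fp] := Fe e e0; exists (p n).
  suff: F [set x : linfty R | ball (p n) e (x n)] by [].
  apply: filterS Fp => x px /=.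
  by rewrite -ball_normE; apply: le_lt_trans (le_linfty_dist p x n) px.
pose l n := lim ((fun x : linfty R => x n) @ F).
have Fl e p : F [set x : linfty R | `|p - x| < e] ->
    forall n, `|p n - l n| <= e.
  move=> Fp n; apply/ler_addgt0Pr => d d0.
  have /cvgr_dist_lt/(_ d d0) Fd := Fn n.
  have [x [/= px xl]] := filter_ex (filterI Fp Fd).
  rewrite -(subrKA (x n)) (le_trans (ler_normD _ _))// lerD//.
    exact: le_trans (le_linfty_dist p x n) (ltW px).
  by rewrite distrC ltW.
have lb : l \in @bounded_seq R.
  have [p Fp] := Fe 1 ltr01; apply/bounded_seqP; exists (`|p| + 1) => n.
  rewrite -[l n](subKr (p n)) (le_trans (ler_normB _ _))// lerD//.
    exact: le_linfty_norm.
  exact: Fl.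
apply/cvg_ex; exists (Linfty lb); apply/cvgrPdist_le => e e0.
have e20 : 0 < e / 2 by rewrite divr_gt0.
have [p Fp] := Fe _ e20; apply: filterS (Fp) => x /= px.
rewrite -(subrKA p) [e]splitr (le_trans (ler_normD _ _))// lerD ?(ltW px)//.
by apply: linfty_norm_le => n; rewrite -normrN opprB; exact: Fl.
Qed.

HB.instance Definition _ :=
  Uniform_isComplete.Build (linfty R) linfty_complete.

End linfty_normed.

(* Closure under finite unions is stated for binary ones; [I set0] follows
   from [ideal_set1] and [ideal_sub]. *)
Record is_ideal (I : set_system nat) : Prop := IsIdeal {
  ideal_proper : I <> setT ;
  ideal_sub : forall A B : set nat, A `<=` B -> I B -> I A ;
  ideal_setU : forall A B : set nat, I A -> I B -> I (A `|` B) ;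
  ideal_set1 : forall n : nat, I [set n] }.

Definition ideal_cluster (R : realType) (I : set_system nat) (x : nat -> R) :
    set R :=
  [set eta | forall eps : R, 0 < eps -> ~ I [set n | `|x n - eta| < eps]].

(* The cardinal is represented by an arbitrary set [K] of that cardinality. *)
Definition Gamma (R : realType) (I : set_system nat) (U : Type) (K : set U) :
    set (linfty R) :=
  [set x | (ideal_cluster I x #= K)%card].

Arguments Gamma R I {U} K.

Definition densely_lineable (K : numDomainType) (X : topologicalLmodType K)
    (M : set X) : Prop :=
  exists V : set X,
    [/\ submod_closed (mem V), dense V & V `<=` M `|` [set 0]].

(* Main.v *)
(** Let [S] be the dense space of finite-valued sequences and [M] the space of
    those in [S] that are constant outside a set of [I].  A sequence in [S] has
    finitely many cluster points, and at least two unless it lies in [M]; so it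
    suffices to find a dense subspace of [S] meeting [M] trivially.
    Index countably many disjoint [I]-positive sets by pairs, and let [T_n x] be
    the sequence with value [x i] on the set of index [(n, i)] and [0] elsewhere.
    The span [W] of all [x + T_n x / (n + 1)], with [x] in [M], meets [M]
    trivially and has [M] in its closure.  By Zorn's lemma [W] extends to a
    complement [V] of [M], and the closure of [V] contains [V + M]. *)
Require Import Defs.
From mathcomp Require Import all_boot all_order all_algebra.
From mathcomp Require Import all_classical all_reals all_analysis.
From mathcomp Require Import lra.
Set Implicit Arguments.
Unset Strict Implicit.
Unset Printing Implicit Defensive.
Import Order.TTheory GRing.Theory Num.Theory.
Import numFieldNormedType.Exports.
Local Open Scope ring_scope.
Local Open Scope classical_set_scope.

(** * Subspaces and their complements *)

Section Subspaces.
Context {K : fieldType} {V : lmodType K}.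
Implicit Types A B M W : set V.

Lemma submod_setP A :
  submod_closed (mem A) <->
  A 0 /\ forall a x y, A x -> A y -> A (a *: x + y).
Proof.
split=> [[/set_mem A0 Al]|[A0 Al]]; split=> //.
- by move=> a x y /mem_set Ax /mem_set Ay; apply: set_mem; exact: Al.
- exact: mem_set.
- by move=> a x y /set_mem Ax /set_mem Ay; apply: mem_set; exact: Al.
Qed.

Lemma submod_setI A B : submod_closed (mem A) -> submod_closed (mem B) ->
  submod_closed (mem (A `&` B)).
Proof.
move=> /submod_setP[A0 Al] /submod_setP[B0 Bl]; apply/submod_setP; split=> //.
by move=> a x y [Ax Bx] [Ay By]; split; [exact: Al|exact: Bl].
Qed.

Lemma submod_setD A x y : submod_closed (mem A) -> A x -> A y -> A (x + y).
Proof. by move=> /submod_setP[_ Al] Ax Ay; rewrite -[x]scale1r; exact: Al. Qed.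

Lemma submod_setZ A a x : submod_closed (mem A) -> A x -> A (a *: x).
Proof. by move=> /submod_setP[A0 Al] Ax; rewrite -[_ *: _]addr0; exact: Al. Qed.

Lemma submod_setB A x y : submod_closed (mem A) -> A x -> A y -> A (x - y).
Proof.
move=> sA Ax Ay; apply: (submod_setD sA Ax).
by rewrite -scaleN1r; exact: submod_setZ.
Qed.

Lemma submod_set_sum A (x : nat -> V) N : submod_closed (mem A) ->
  (forall n, A (x n)) -> A (\sum_(n < N) x n).
Proof.
move=> sA Ax; apply: big_ind => //; first by case/submod_setP: sA.
by move=> u v; exact: submod_setD.
Qed.

(** Zorn's lemma gives a maximal subspace [C] containing [W] and meeting [M] trivially. A vector
    outside [C + M] could be adjoined to [C], so [C + M] is the whole space. *)
Lemma exists_complement_containing W M :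
  submod_closed (mem W) -> submod_closed (mem M) -> W `&` M `<=` [set 0] ->
  exists C, [/\ submod_closed (mem C), W `<=` C, C `&` M `<=` [set 0] &
    forall x, exists2 c, C c & M (x - c)].
Proof.
move=> sW sM WM0.
(* Taking the union with [W] makes the empty set admissible, as the bound of the empty chain. *)
pose P A := submod_closed (mem (W `|` A)) /\ (W `|` A) `&` M `<=` [set 0].
have [F FP Ftot|A [[sA AM0] Amax]] := @Zorn_bigcup V P.
  have [->|/set0P[A0 FA0]] := eqVneq F set0.
    by rewrite /P bigcup_set0 setU0.
  have lift x : (W `|` \bigcup_(A in F) A) x -> exists2 A, F A & (W `|` A) x.
    by move=> [Wx|[A FA Ax]]; [exists A0 => //; left|exists A => //; right].
  split; last first.
    by move=> x [/lift[A FA Ax] Mx]; exact: (proj2 (FP _ FA) x (conj Ax Mx)).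
  apply/submod_setP; split; first by left; case/submod_setP: sW.
  move=> a x y /lift[A FA Ax] /lift[B FB By].
  have [C [FC AC BC]] : exists C, [/\ F C, A `<=` C & B `<=` C].
    by have [AB|BA] := Ftot _ _ FA FB; [exists B|exists A]; split=> //; exact: subset_refl.
  have /submod_setP[_ Cl] := proj1 (FP _ FC).
  have [Wz|Cz] : (W `|` C) (a *: x + y); [|by left|by right; exists C].
  by apply: Cl; [case: Ax => [|/AC]|case: By => [|/BC]]; by [left|right].
set C := W `|` A in sA AM0.
exists C; split=> // [x|x]; first by left.
have C0 : C 0 by case/submod_setP: sA.
apply: contrapT => nx.
pose D := [set c + a *: x | c in C & a in [set: K]].
have CD : C `<=` D.
  by move=> c Cc; exists c => //; exists 0; rewrite // scale0r addr0.
have WD : W `|` D = D by apply/setUidPr => w Ww; apply: CD; left.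
apply: (Amax D); last first.
  rewrite /P WD; split.
    apply/submod_setP; split; first exact: CD.
    move=> a _ _ [c Cc [b _ <-]] [d Cd [e _ <-]].
    exists (a *: c + d); first by case/submod_setP: sA => _; apply.
    by exists (a * b + e) => //; rewrite scalerDr scalerDl scalerA addrACA.
  move=> _ [[c Cc [a _ <-]] Mz]; have [a0|a0] := eqVneq a 0.
    by apply: AM0; split; move: Mz; rewrite a0 scale0r addr0.
  (* If [c + a *: x] is in [M] with [a] nonzero, then [x = - a^-1 *: c + a^-1 *: (c + a *: x)] lies
     in [C + M]. *)
  exfalso; apply: nx; exists (- a^-1 *: c); first exact: submod_setZ.
  rewrite scaleNr opprK addrC -[x]scale1r -(mulVf a0) -scalerA -scalerDr.
  exact: submod_setZ.
split; first by move=> z Az; apply: CD; right.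
move=> DA; apply: nx; exists x; last by rewrite subrr; case/submod_setP: sM.
by right; apply: DA; exists 0 => //; exists 1; rewrite // scale1r add0r.
Qed.

End Subspaces.

(** * Ideals and positive fibers *)

Section Ideals.
Context {I : set_system nat} (hI : is_ideal I).

Lemma ideal_set0 : I set0.
Proof. exact: ideal_sub hI _ _ (sub0set [set 0%N]) (ideal_set1 hI 0%N). Qed.

Lemma ideal_bigcup (T : choiceType) (D : set T) (F : T -> set nat) :
  finite_set D -> (forall i, D i -> I (F i)) -> I (\bigcup_(i in D) F i).
Proof.
move=> /finite_seqP[s ->] IF; rewrite bigcup_seq big_seq.
apply: big_ind => [|A B|i]; [exact: ideal_set0|exact: ideal_setU|exact: IF].
Qed.

(** Pairs are coded as naturals, so the fiber over [p] contains [B (pickle p)]. Points outside every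
    [B j] get a default pair, which only enlarges one fiber. *)
Lemma trivIset_positive_fibers (B : nat -> set nat) : trivIset setT B ->
  (forall j, ~ I (B j)) ->
  exists g : nat -> nat * nat, forall p, ~ I (g @^-1` [set p]).
Proof.
move=> tB IB.
exists (fun m => odflt (0, 0)%N (unpickle (xget 0%N [set j | B j m]))) => p.
apply: contra_not (IB (pickle p)); apply: (ideal_sub hI) => m Bm /=.
case: xgetP => [j _ /= Bj|/(_ (pickle p))//].
by rewrite (tB j (pickle p)) ?pickleK//; exists m.
Qed.

End Ideals.

(** * Density of the finite-valued sequences *)

Section FiniteRange.
Context {R : realType}.
Implicit Types x y : linfty R.

Lemma linfty_sumE N (x : 'I_N -> linfty R) m :
  (\sum_(n < N) x n) m = \sum_(n < N) x n m.
Proof. by elim/big_rec2 : _ => // n u v _ <-. Qed.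

Definition finite_range : set (linfty R) := [set x | finite_set (range x)].

Lemma finite_range_submod : submod_closed (mem finite_range).
Proof.
apply/submod_setP; split=> [|a x y fx fy].
  by apply: sub_finite_set (finite_set1 0) => _ [n _ <-].
exact: (finite_image11 (fun u v => a * u + v) fx fy).
Qed.

Lemma finite_range_approx y (e : R) : 0 < e ->
  exists2 x, finite_range x & `|y - x| <= e.
Proof.
move=> e0; pose b := linfty_norm y.
have yb n : 0 <= y n + b <= b + b.
  have := le_linfty_norm y n; rewrite -/b ler_norml => /andP[h1 h2].
  by rewrite lerD2r h2 -(subrr b) [y n + b]addrC lerD2l h1.
(* The values of [y + b] are rounded down to multiples of [e]. They lie between [0] and [b + b], so
   truncation is the floor and only finitely many multiples occur. *)
pose k n := Num.truncn ((y n + b) / e).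
pose K := Num.truncn ((b + b) / e).
have kK n : (k n <= K)%N.
  by apply: le_truncn; rewrite ler_pM2r ?invr_gt0//; case/andP: (yb n).
pose x n := e * (k n)%:R - b.
have yx n : `|y n - x n| <= e.
  have /truncn_itv/andP[] : 0 <= (y n + b) / e.
    by rewrite divr_ge0 ?(ltW e0)//; case/andP: (yb n).
  rewrite -/(k n) ler_pdivlMr// ltr_pdivrMr// -natr1 mulrDl mul1r => h1 h2.
  have -> : y n - x n = y n + b - (k n)%:R * e.
    by rewrite /x mulrC opprB addrA.
  by rewrite ger0_norm ?subr_ge0// lerBlDl ltW.
have xb : x \in @bounded_seq R.
  apply/bounded_seqP; exists (b + e) => n.
  rewrite -[x n](subKr (y n)) (le_trans (ler_normB _ _))// lerD//.
  exact: le_linfty_norm.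
exists (Linfty xb); last exact: linfty_norm_le.
apply: (@sub_finite_set _ _ [set e * i%:R - b | i in `I_K.+1]).
  by move=> _ [n _ <-]; exists (k n) => //=; rewrite ltnS.
exact/finite_image/finite_II.
Qed.

(** * Constancy modulo the ideal and cluster points *)

Context {I : set_system nat} (hI : is_ideal I).

Definition ae_constant : set (linfty R) :=
  [set x | exists c, I [set n | x n != c]].

Lemma ae_constant_submod : submod_closed (mem ae_constant).
Proof.
apply/submod_setP; split=> [|a x y [c Ic] [d Id]].
  exists 0; apply: (ideal_sub hI) (ideal_set0 hI) => n /=.
  by rewrite eqxx.
exists (a * c + d); apply: (ideal_sub hI) (ideal_setU hI Ic Id) => n.
rewrite /= -[X in X != _]/(a * x n + y n); apply: contra_neqP => /not_orP[].
by move=> /negP/negPn/eqP-> /negP/negPn/eqP->.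
Qed.

(** A finite set of reals is closed, so a point outside the range has a neighborhood that [x] never
    enters. *)
Lemma ideal_cluster_sub_range x : finite_range x ->
  ideal_cluster I x `<=` range x.
Proof.
move=> fx c clc; apply: contrapT => nc.
have : open (~` range x).
  apply/closed_openC/(proj1 accessible_finite_set_closed _ _ fx).
  exact/hausdorff_accessible/norm_hausdorff.
rewrite openE => /(_ c nc)/nbhs_ballP[e /= e0 ce].
apply: (clc e e0); apply: (ideal_sub hI) (ideal_set0 hI) => n /= xn.
by apply: (ce (x n)); [rewrite -ball_normE /= distrC|exists n].
Qed.

(** Each value other than [c] fails to be a cluster point, so its level set is in [I]; there are
    finitely many such level sets. *)
Lemma ae_constant_one_cluster x c : finite_range x ->
  ideal_cluster I x `<=` [set c] -> ae_constant x.
Proof.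
move=> fx xc; exists c.
have : I (\bigcup_(d in range x `\ c) [set n | x n = d]).
  apply: (ideal_bigcup hI); first exact: finite_setD.
  move=> d [_ /= dc].
  have /existsNP[e /not_implyP[e0 /contrapT Ie]] : ~ ideal_cluster I x d.
    by move=> /xc.
  by apply: (ideal_sub hI) Ie => n /= ->; rewrite subrr normr0.
by apply: (ideal_sub hI) => n /eqP xnc; exists (x n) => //; split => //; exists n.
Qed.

Lemma Gamma_finite_range x : finite_range x -> ~ ae_constant x ->
  (\bigcup_(n in [set n | (2 <= n)%N]) Gamma R I `I_n) x.
Proof.
move=> fx nx.
have /finite_setP[n xn] := sub_finite_set (ideal_cluster_sub_range fx) fx.
exists n => //=; rewrite leqNgt; apply/negP => n2; apply: nx.
have : (ideal_cluster I x #<= `I_1)%card.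
  by rewrite (card_le_eql xn) card_le_II.
move=> /pcard_leP[f].
(* An injection into a one-point set leaves at most one cluster point; if there is none, any [c]
   will do. *)
have [c xc] : exists c, ideal_cluster I x `<=` [set c].
  have [->|/set0P[c xc]] := eqVneq (ideal_cluster I x) set0; first by exists 0.
  exists c => d xd; apply: (@inj _ _ (ideal_cluster I x) f); rewrite ?inE//.
  have := @funS _ _ _ _ f c xc; have := @funS _ _ _ _ f d xd.
  by rewrite /= !ltnS !leqn0 => /eqP-> /eqP->.
exact: (ae_constant_one_cluster fx xc).
Qed.

(** * Perturbation by copies on the fibers *)

Context {g : nat -> nat * nat} (Ig : forall p, ~ I (g @^-1` [set p])).

Lemma spread_bounded n x :
  (fun m => if (g m).1 == n then x (g m).2 else 0) \in @bounded_seq R.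
Proof.
apply/bounded_seqP; exists (linfty_norm x) => m; case: eqP => _.
  exact: le_linfty_norm.
by rewrite normr0 (le_trans _ (le_linfty_norm x 0%N)).
Qed.

(* [spread n] copies [x i] onto the fiber of [g] over [(n, i)], so a
   finite sum of [spread n (x n)] is constant outside a set of [I] only if all
   the [x n] vanish: it is [0] on the fibers over [(n, i)] for large [n]. *)
Definition spread n x : linfty R := Linfty (spread_bounded n x).

Lemma spread_linear n a x y :
  spread n (a *: x + y) = a *: spread n x + spread n y.
Proof.
apply/val_inj/funext => m; rewrite /= -[RHS]/(a * spread n x m + spread n y m) /=.
by case: eqP => _ //; rewrite mulr0 addr0.
Qed.

Lemma spread0 n : spread n 0 = 0.
Proof.
by have := spread_linear n (-1) 0 0; rewrite scaler0 addr0 scaleN1r addNr.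
Qed.

Lemma spread_norm n x : `|spread n x| <= `|x|.
Proof.
apply: linfty_norm_le => m /=; case: eqP => _; first exact: le_linfty_norm.
by rewrite normr0; exact: (normr_ge0 x).
Qed.

Lemma spread_finite_range n x : finite_range x -> finite_range (spread n x).
Proof.
move=> fx; apply: (@sub_finite_set _ _ (range x `|` [set 0])).
  move=> _ [m _ <-] /=; case: eqP => _; last by right.
  by left; exists (g m).2.
by rewrite finite_setU.
Qed.

(** Since [spread n] does not increase the norm, the factor makes [perturb n x] tend to [x] as [n]
    grows. *)
Definition perturb n x : linfty R := x + n.+1%:R^-1 *: spread n x.

Lemma perturb_linear n a x y :
  perturb n (a *: x + y) = a *: perturb n x + perturb n y.
Proof.
rewrite /perturb spread_linear !scalerDr !scalerA [a * _]mulrC.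
by rewrite addrACA.
Qed.

Lemma perturb0 n : perturb n 0 = 0.
Proof. by rewrite /perturb spread0 scaler0 addr0. Qed.

Lemma perturb_finite_range n x : finite_range x -> finite_range (perturb n x).
Proof.
move=> fx; apply: (submod_setD finite_range_submod) => //.
by apply: (submod_setZ _ finite_range_submod); exact: spread_finite_range.
Qed.

Let M : set (linfty R) := finite_range `&` ae_constant.

(** This is the span of all [perturb n x] with [x] in [M]: by linearity of [perturb n], one [x n]
    for each [n] suffices. Asking for the sum at all large [N] lets two elements be added without
    matching their lengths. *)
Definition perturbations : set (linfty R) :=
  [set w | exists2 x : nat -> linfty R, (forall n, M (x n)) &
    \forall N \near \oo, x N = 0 /\ w = \sum_(n < N) perturb n (x n)].

Let subM : submod_closed (mem M).
Proof. exact: submod_setI finite_range_submod ae_constant_submod. Qed.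

Lemma perturbations_submod : submod_closed (mem perturbations).
Proof.
apply/submod_setP; split.
  exists (fun=> 0) => [n|]; first by case/submod_setP: subM.
  by near=> N; split => //; rewrite big1// => n _; rewrite perturb0.
move=> a w1 w2 [x Mx xw1] [y My yw2].
exists (fun n => a *: x n + y n) => [n|].
  by case/submod_setP: subM => _; apply.
near=> N.
have [xN ->] : x N = 0 /\ w1 = \sum_(n < N) perturb n (x n) by near: N.
have [yN ->] : y N = 0 /\ w2 = \sum_(n < N) perturb n (y n) by near: N.
split; first by rewrite xN yN scaler0 addr0.
by rewrite scaler_sumr -big_split; apply: eq_bigr => n _; rewrite perturb_linear.
Unshelve. all: by end_near. Qed.

Lemma perturb_in n x : M x -> perturbations (perturb n x).
Proof.
move=> Mx; exists (fun k => if k == n then x else 0) => [k|].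
  by case: eqP => // _; case/submod_setP: subM.
near=> N.
have nN : (n < N)%N by near: N; exact: nbhs_infty_gt.
split; first by rewrite gtn_eqF.
rewrite (bigD1 (Ordinal nN))//= eqxx big1 ?addr0// => k /negPf kn.
rewrite -(inj_eq val_inj) /= in kn.
by rewrite kn perturb0.
Unshelve. all: by end_near. Qed.

(** Write [w] as the sum of the [x n] plus [D N0]. The first term is in [M], so [D N0] is too, and
    comparing its values on the positive fibers forces every [x n] to vanish. *)
Lemma perturbations_ae_constant : perturbations `&` M `<=` [set 0].
Proof.
move=> w [[x Mx xw] Mw].
have [N0 _ {}xw] := xw.
pose D N : linfty R := \sum_(n < N) n.+1%:R^-1 *: spread n (x n).
have DE N m : D N m =
    if ((g m).1 < N)%N then (g m).1.+1%:R^-1 * x (g m).1 (g m).2 else 0.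
  have spreadE (n : nat) : (n.+1%:R^-1 *: spread n (x n)) m =
      if (g m).1 == n then n.+1%:R^-1 * x n (g m).2 else 0.
    rewrite -[LHS]/(n.+1%:R^-1 * (if (g m).1 == n then x n (g m).2 else 0)).
    by case: eqP => // _; rewrite mulr0.
  rewrite /D linfty_sumE; case: ltnP => [gN|gN].
    rewrite (bigD1 (Ordinal gN))// spreadE eqxx big1 => [|k]; first exact: addr0.
    by rewrite spreadE -(inj_eq val_inj) /= eq_sym => /negPf ->.
  rewrite big1// => k _; rewrite spreadE gtn_eqF//.
  exact: leq_trans gN.
have wE N : (N0 <= N)%N -> w = \sum_(n < N) x n + D N.
  by move=> /xw[_ ->]; rewrite -big_split.
have x0 k : x k = 0.
  have [kN|/xw[]//] := ltnP k N0.
  have [_ [c Dc]] : M (D N0).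
    have -> : D N0 = w - \sum_(n < N0) x n by rewrite {1}(wE N0)// addrC addKr.
    by apply: (submod_setB subM) => //; exact: submod_set_sum.
  (* A fiber is not in [I], so it is not contained in the exceptional set of [D N0]. *)
  have Dp p : exists2 m, g m = p & D N0 m = c.
    have /existsNP[m /not_implyP[gm /negP/negPn/eqP mc]] :
        ~ (g @^-1` [set p] `<=` [set m | D N0 m != c]).
      by move=> /(ideal_sub hI)/(_ Dc); exact: Ig.
    by exists m.
  (* [N0] is the first index absent from the sum, so [D N0] vanishes on the fiber over [(N0, 0)]. *)
  have c0 : c = 0.
    by have [m gm <-] := Dp (N0, 0%N); rewrite DE gm ltnn.
  apply/val_inj/funext => i /=.
  have [m gm] := Dp (k, i); rewrite DE gm kN c0 => /eqP.
  by rewrite mulf_eq0 invr_eq0 pnatr_eq0 /= => /eqP.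
rewrite (wE N0)// /D; apply/eqP; rewrite addr_eq0; apply/eqP.
rewrite !big1 ?oppr0// => k _; rewrite x0//.
by rewrite spread0 scaler0.
Qed.

End FiniteRange.

(** * Density of the finite-valued part of the complement *)

Theorem mainTheorem10 (R : realType) (I : set_system nat) (hI : is_ideal I)
    (hB : exists B : nat -> set nat,
        trivIset setT B /\ forall j : nat, ~ I (B j)) :
  densely_lineable (\bigcup_(n in [set n | (2 <= n)%N]) Gamma R I `I_n).
Proof.
have [B [tB IB]] := hB.
have [g Ig] := trivIset_positive_fibers hI tB IB.
have subM := submod_setI (@finite_range_submod R) (ae_constant_submod hI).
have [V [subV WV VM VMT]] := exists_complement_containing
  (perturbations_submod hI (g := g)) subM (perturbations_ae_constant hI Ig).
(* [V] is a complement of [M] in all of [linfty R], hence the intersection. *)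
exists (V `&` finite_range); split.
- exact: submod_setI finite_range_submod.
- move=> O [y Oy] oO.
  have /nbhs_ballP[e /= e0 yeO] := open_nbhs_nbhs (conj oO Oy).
  have e40 : 0 < e / 4 by rewrite divr_gt0.
  (* The target [y] is within [e / 4] of a finite-valued [s = v + m]. Replacing [m] by
     [perturb n m], which lies in [V], costs at most another [e / 4] for large [n]. *)
  have [s fs ys] := finite_range_approx y e40.
  have [v Vv Mm] := VMT s; set m := s - v in Mm.
  have [n mn] : exists n, `|m| / n.+1%:R <= e / 4.
    exists (Num.truncn (`|m| / (e / 4))).
    rewrite ler_pdivrMr// mulrC -ler_pdivrMr//.
    by rewrite ltW// truncnS_gt.
  have fv : finite_range v.
    by rewrite -[v](subKr s); apply: (submod_setB finite_range_submod) fs Mm.1.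
  exists (v + perturb (g := g) n m); split; last first.
    split; last first.
      apply: (submod_setD finite_range_submod) => //.
      exact: perturb_finite_range Mm.1.
    by apply: (submod_setD subV) => //; exact/WV/perturb_in.
  apply: yeO; rewrite -ball_normE /=.
  rewrite /perturb addrA [v + m]addrC subrK opprD addrA.
  rewrite (le_lt_trans (ler_normB _ _))//.
  rewrite (@le_lt_trans _ _ (e / 4 + e / 4))//; last by lra.
  rewrite lerD// normrZ ger0_norm// mulrC (le_trans _ mn)//.
  by rewrite ler_wpM2r// spread_norm.
- move=> x [Vx fx]; have [->|x0] := eqVneq x 0; [by right|left].
  (* Were [x] constant outside a set of [I], it would lie in both [V] and [M], hence vanish. *)
  apply: (Gamma_finite_range hI fx) => ax.
  by move/eqP: x0; apply; apply: VM; split => //; split.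
Qed.
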